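(* The variety $\mathcal{V}_{\sigma\ell\mathbb{G}_u}$ is generated by $\mathbb{R}$: every $G\in\mathcal{V}_{\sigma\ell\mathbb{G}_u}$ is isomorphic to a subalgebra of a quotient of a power of the algebra $(\mathbb{R},0,+,-,\vee,\wedge,\bigvee^-,1)$, where in $\mathbb{R}$ one sets $\bigvee^-(g,f_1,f_2,\dots)=\sup_{n\ge1}\{f_n\wedge g\}$ and $1$ is the real number $1$.
   Context: $\mathcal{V}_{\sigma\ell\mathbb{G}_u}$ is the infinitary variety of algebras $(G,0,+,-,\vee,\wedge,\bigvee^-,1)$, $\bigvee^-$ of countably infinite arity ($\bigvee_{n\ge1}^g f_n:=\bigvee^-(g,f_1,f_2,\dots)$), $1$ a constant, satisfying the $\ell$-group axioms, (A1) $\bigvee_{n\ge1}^g f_n=\bigvee_{n\ge1}^g(f_n\wedge g)$; (A2) $\bigvee_{n\ge1}^g f_n=(f_1\wedge g)\vee\bigvee^-(g,f_2,f_3,\dots)$; (A3) $\bigvee_{n\ge1}^g(f_n\wedge h)\le h$ ($a\le b$ meaning $a\wedge b=a$); and $\bigvee_{n\ge1}^{|f|}(|f|\wedge n1)=|f|$. *)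

(* Defs.v *)
From Stdlib Require Import Reals.
Open Scope R_scope.

(** Algebras of the signature (0,+,-,\/,/\,\bigvee^-,1);
    [bigv g f] stands for \bigvee^-(g, f_1, f_2, ...), with f_{n+1} := f n. *)
Record SigAlg := {
  car :> Type;
  zero : car;
  add : car -> car -> car;
  opp : car -> car;
  join : car -> car -> car;
  meet : car -> car -> car;
  bigv : car -> (nat -> car) -> car;
  one : car
}.

Arguments zero {s}. Arguments add {s}. Arguments opp {s}. Arguments join {s}.
Arguments meet {s}. Arguments bigv {s}. Arguments one {s}.

Definition leA {A : SigAlg} (a b : A) : Prop := meet a b = a.
Definition absA {A : SigAlg} (a : A) : A := join a (opp a).
Fixpoint natmul {A : SigAlg} (n : nat) (a : A) : A :=
  match n with O => zero | S k => add (natmul k a) a end.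

Definition lgroup_axioms (A : SigAlg) : Prop :=
  (forall a b c : A, add a (add b c) = add (add a b) c) /\
  (forall a b : A, add a b = add b a) /\
  (forall a : A, add a zero = a) /\
  (forall a : A, add a (opp a) = zero) /\
  (forall a b c : A, join a (join b c) = join (join a b) c) /\
  (forall a b c : A, meet a (meet b c) = meet (meet a b) c) /\
  (forall a b : A, join a b = join b a) /\
  (forall a b : A, meet a b = meet b a) /\
  (forall a b : A, join a (meet a b) = a) /\
  (forall a b : A, meet a (join a b) = a) /\
  (forall a b c : A, add a (join b c) = join (add a b) (add a c)).

Definition in_variety (A : SigAlg) : Prop :=
  lgroup_axioms A /\
  (forall (g : A) (f : nat -> A), bigv g f = bigv g (fun n => meet (f n) g)) /\
  (forall (g : A) (f : nat -> A),
      bigv g f = join (meet (f O) g) (bigv g (fun n => f (S n)))) /\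
  (forall (g h : A) (f : nat -> A), leA (bigv g (fun n => meet (f n) h)) h) /\
  (forall f : A, bigv (absA f) (fun n => meet (absA f) (natmul (S n) one)) = absA f).

Definition R_bigv_set (g : R) (f : nat -> R) : R -> Prop :=
  fun x => exists n : nat, x = Rmin (f n) g.

Lemma R_bigv_bound (g : R) (f : nat -> R) : bound (R_bigv_set g f).
Proof. exists g. intros x [n ->]. apply Rmin_r. Qed.

Lemma R_bigv_ne (g : R) (f : nat -> R) : exists x, R_bigv_set g f x.
Proof. exists (Rmin (f O) g). exists O. reflexivity. Qed.

Definition R_bigv (g : R) (f : nat -> R) : R :=
  proj1_sig (completeness (R_bigv_set g f) (R_bigv_bound g f) (R_bigv_ne g f)).

Definition R_alg : SigAlg :=
  {| car := R; zero := 0; add := Rplus; opp := Ropp; join := Rmax;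
     meet := Rmin; bigv := R_bigv; one := 1 |}.

Definition power_alg (I : Type) (A : SigAlg) : SigAlg :=
  {| car := I -> A;
     zero := fun _ => zero;
     add := fun x y i => add (x i) (y i);
     opp := fun x i => opp (x i);
     join := fun x y i => join (x i) (y i);
     meet := fun x y i => meet (x i) (y i);
     bigv := fun g f i => bigv (g i) (fun n => f n i);
     one := fun _ => one |}.

Definition congruence {A : SigAlg} (th : A -> A -> Prop) : Prop :=
  (forall a, th a a) /\ (forall a b, th a b -> th b a) /\
  (forall a b c, th a b -> th b c -> th a c) /\
  (forall a a' b b', th a a' -> th b b' -> th (add a b) (add a' b')) /\
  (forall a a', th a a' -> th (opp a) (opp a')) /\
  (forall a a' b b', th a a' -> th b b' -> th (join a b) (join a' b')) /\
  (forall a a' b b', th a a' -> th b b' -> th (meet a b) (meet a' b')) /\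
  (forall g g' (f f' : nat -> A), th g g' -> (forall n, th (f n) (f' n)) ->
      th (bigv g f) (bigv g' f')).

(** [quot_embedding th phi]: the map x |-> [phi x]_th from G to the quotient
    algebra B/th is an injective homomorphism, i.e. G is isomorphic (via it)
    to a subalgebra (its image) of B/th. *)
Definition quot_embedding {G B : SigAlg} (th : B -> B -> Prop) (phi : G -> B) : Prop :=
  th (phi zero) zero /\
  (forall a b, th (phi (add a b)) (add (phi a) (phi b))) /\
  (forall a, th (phi (opp a)) (opp (phi a))) /\
  (forall a b, th (phi (join a b)) (join (phi a) (phi b))) /\
  (forall a b, th (phi (meet a b)) (meet (phi a) (phi b))) /\
  (forall g (f : nat -> G), th (phi (bigv g f)) (bigv (phi g) (fun n => phi (f n)))) /\
  th (phi one) one /\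
  (forall a b, th (phi a) (phi b) -> a = b).

(* Main.v *)
(* The points of the power are all maps x : G -> R, with a represented by
   x |-> x a; two functions are congruent when they agree at every x that
   respects the operations on each of countably many given sequences.  Everything
   is then immediate except injectivity: if a is not below b, some x respecting
   countably many sequences must satisfy x b < x a.  Positive elements p of G,
   thought of as supports, are forcing conditions for such an x, p forcing h >= 0
   when p is disjoint from the negative part of h.  By the Rasiowa-Sikorski lemma
   there is a decreasing sequence of conditions that decides the sign of every
   element of a countable l-subgroup, bounds each of them by a multiple of 1
   (this is where 1 being a weak unit enters), makes a - b positive, and
   preserves the given countable suprema.  The forced elements form a total cone
   in which 1 is a strong unit, and Hoelder's construction by rational cuts turns
   it into a real-valued homomorphism. *)
Require Import Defs.
From Stdlib Require Import Reals ZArith Lia Lra Ring Cantor Classical ClassicalEpsilon FunctionalExtensionality.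

Local Notation "a [+] b" := (add a b) (at level 50, left associativity).
Local Notation "[-] a" := (opp a) (at level 35, right associativity).
Local Notation "a [-] b" := (add a (opp b)) (at level 50, left associativity).
Local Notation "a [\/] b" := (join a b) (at level 45, left associativity).
Local Notation "a [/\] b" := (meet a b) (at level 45, left associativity).
Local Notation "a [<=] b" := (leA a b) (at level 70, no associativity).

(** * Integer multiples, rationals and suprema in [R] *)

Definition zmul {A : SigAlg} (z : Z) (a : A) : A :=
  match z with
  | Z0 => zero
  | Zpos p => natmul (Pos.to_nat p) a
  | Zneg p => opp (natmul (Pos.to_nat p) a)
  end.
Local Notation "z [*] a" := (zmul z a) (at level 40, left associativity).

Lemma lt_rational (x y : R) : x < y ->
  exists n m, (0 < n)%Z /\ x < IZR m / IZR n < y.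
Proof.
intros L. destruct (archimed (/ (y - x))) as [HN _]. set (N := up _) in *.
assert (Hi : 0 < / (y - x)) by (apply Rinv_0_lt_compat; lra).
assert (HN0 : 0 < IZR N) by lra.
(* As [N > 1 / (y - x)], the interval from [N x] to [N y] is longer than 1, so the first integer
   above [N x] lies in it. *)
exists N, (up (x * IZR N)). split; [now apply lt_IZR|].
destruct (archimed (x * IZR N)) as [H1 H2].
assert (H3 : 1 < IZR N * (y - x)).
{ rewrite <- (Rinv_l (y - x)) by lra. apply Rmult_lt_compat_r; lra. }
split; apply (Rmult_lt_reg_r (IZR N)); trivial;
  unfold Rdiv; rewrite Rmult_assoc, Rinv_l by lra; lra.
Qed.

Lemma R_bigv_unique (g : R) (f : nat -> R) (r : R) :
  is_lub (R_bigv_set g f) r -> R_bigv g f = r.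
Proof.
intros Hr. apply (is_lub_u (R_bigv_set g f)); [|easy].
apply (proj2_sig (completeness _ (R_bigv_bound g f) (R_bigv_ne g f))).
Qed.

(** * Abelian group arithmetic and integer multiples *)

Section LatticeGroup.

Context {G : SigAlg} (HG : lgroup_axioms G).
Implicit Types (a b c d w p h : G).

Lemma addA a b c : a [+] (b [+] c) = a [+] b [+] c. Proof. apply HG. Qed.
Lemma addC a b : a [+] b = b [+] a. Proof. apply HG. Qed.
Lemma add0 a : a [+] zero = a. Proof. apply HG. Qed.
Lemma addN a : a [-] a = zero. Proof. apply HG. Qed.
Lemma joinC a b : a [\/] b = b [\/] a. Proof. apply HG. Qed.
Lemma meetC a b : a [/\] b = b [/\] a. Proof. apply HG. Qed.
Lemma meetA a b c : a [/\] (b [/\] c) = a [/\] b [/\] c. Proof. apply HG. Qed.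
Lemma joinA a b c : a [\/] (b [\/] c) = a [\/] b [\/] c. Proof. apply HG. Qed.
Lemma joinK a b : a [\/] (a [/\] b) = a. Proof. apply HG. Qed.
Lemma meetK a b : a [/\] (a [\/] b) = a. Proof. apply HG. Qed.
Lemma add_joinr a b c : a [+] (b [\/] c) = (a [+] b) [\/] (a [+] c). Proof. apply HG. Qed.

Lemma add0l a : zero [+] a = a. Proof. now rewrite addC, add0. Qed.

Lemma add_cancel a b c : a [+] b = a [+] c -> b = c.
Proof.
intros H. rewrite <- (add0l b), <- (add0l c), <- (addN a), (addC a), <- !addA.
now rewrite H.
Qed.

Lemma oppD a b : [-] (a [+] b) = [-] a [-] b.
Proof.
apply (add_cancel (a [+] b)). rewrite addN, (addC a b), <- addA, (addA a).
now rewrite addN, add0l, addN.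
Qed.

Lemma oppK a : [-] [-] a = a.
Proof. apply (add_cancel ([-] a)). now rewrite addN, addC, addN. Qed.

Lemma opp0 : [-] zero = zero :> G.
Proof. now rewrite <- (add0l ([-] zero)), addN. Qed.

Lemma zmul_natmul n a : Z.of_nat n [*] a = natmul n a.
Proof. destruct n; [easy|]. simpl. now rewrite SuccNat2Pos.id_succ. Qed.

Lemma zmul_opp z a : (- z) [*] a = [-] (z [*] a).
Proof. destruct z; simpl; now rewrite ?opp0, ?oppK. Qed.

Lemma zmul_succ z a : Z.succ z [*] a = z [*] a [+] a.
Proof.
destruct (Z_lt_le_dec z 0) as [Hz|Hz].
- assert (E : exists n, z = (- Z.of_nat (S n))%Z)
    by (exists (Z.to_nat (- z - 1)); lia).
  destruct E as [n ->].
  replace (Z.succ (- Z.of_nat (S n)))%Z with (- Z.of_nat n)%Z by lia.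
  rewrite !zmul_opp, !zmul_natmul. simpl.
  now rewrite oppD, <- addA, (addC _ a), addN, add0.
- rewrite <- (Z2Nat.id z), <- Nat2Z.inj_succ, !zmul_natmul by easy. reflexivity.
Qed.

Lemma zmul_addl x y a : (x + y) [*] a = x [*] a [+] y [*] a.
Proof.
induction y as [|y IH|y IH] using Z.peano_ind.
- now rewrite Z.add_0_r, add0.
- now rewrite Z.add_succ_r, !zmul_succ, IH, addA.
- assert (E : forall z, Z.pred z [*] a = z [*] a [-] a).
  { intros z. rewrite <- (Z.succ_pred z) at 2.
    now rewrite zmul_succ, <- addA, addN, add0. }
  now rewrite Z.add_pred_r, !E, IH, addA.
Qed.

Lemma zmul_addr z a b : z [*] (a [+] b) = z [*] a [+] z [*] b.
Proof.
assert (E : forall n, natmul n (a [+] b) = natmul n a [+] natmul n b).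
{ induction n as [|n IH]; simpl; [now rewrite add0|].
  rewrite IH, <- !addA. f_equal. now rewrite addA, (addC _ a), <- addA. }
destruct z; simpl; rewrite ?E, ?oppD; trivial. now rewrite add0.
Qed.

Lemma zmul_zero z : z [*] zero = zero :> G.
Proof. apply (add_cancel (z [*] zero)). now rewrite <- zmul_addr, !add0. Qed.

Lemma zmul_mul x y a : (x * y) [*] a = x [*] (y [*] a).
Proof.
induction x as [|x IH|x IH] using Z.peano_ind; [easy| |].
- now rewrite Z.mul_succ_l, zmul_addl, zmul_succ, IH.
- rewrite Z.mul_pred_l, <- Z.add_opp_r, zmul_addl, zmul_opp, IH.
  rewrite <- Z.sub_1_r, <- Z.add_opp_r, zmul_addl. f_equal.
  simpl. now rewrite add0l.
Qed.

Lemma zmul_1 a : 1 [*] a = a.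
Proof. simpl. apply add0l. Qed.

(* The trivial square-zero extension of Z by G is a commutative ring in which
   G embeds additively, so [ring] decides the identities of Z-modules in G. *)
Definition ext : Type := (Z * G)%type.
Definition ext_add (x y : ext) : ext := ((fst x + fst y)%Z, snd x [+] snd y).
Definition ext_mul (x y : ext) : ext :=
  ((fst x * fst y)%Z, fst x [*] snd y [+] fst y [*] snd x).
Definition ext_opp (x : ext) : ext := ((- fst x)%Z, [-] (snd x)).
Definition ext_int (z : Z) : ext := (z, zero).
Definition ext_elt (a : G) : ext := (0%Z, a).

Lemma ext_ring : ring_theory (ext_int 0) (ext_int 1) ext_add ext_mul
  (fun x y => ext_add x (ext_opp y)) ext_opp (@eq ext).
Proof.
split; intros; repeat match goal with x : ext |- _ => destruct x as [? ?] end;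
  unfold ext_add, ext_mul, ext_opp, ext_int; cbn [fst snd]; f_equal; try ring.
- apply add0l.
- apply addC.
- apply addA.
- now rewrite zmul_1, zmul_zero, add0.
- apply addC.
- rewrite !zmul_addr, <- !zmul_mul, addA.
  rewrite (Z.mul_comm z1 z), (Z.mul_comm z1 z0), (Z.mul_comm z0 z). reflexivity.
- rewrite zmul_addl, zmul_addr, <- !addA. f_equal.
  now rewrite !addA, (addC (z0 [*] c)).
- apply addN.
Qed.

Add Ring ext_ring_inst : ext_ring.

Lemma ext_elt_inj a b : ext_elt a = ext_elt b -> a = b.
Proof. now intros [= H]. Qed.
Lemma ext_elt_add a b : ext_elt (a [+] b) = ext_add (ext_elt a) (ext_elt b).
Proof. reflexivity. Qed.
Lemma ext_elt_opp a : ext_elt ([-] a) = ext_opp (ext_elt a).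
Proof. reflexivity. Qed.
Lemma ext_elt_zero : ext_elt zero = ext_int 0.
Proof. reflexivity. Qed.
Lemma ext_elt_zmul z a : ext_elt (z [*] a) = ext_mul (ext_int z) (ext_elt a).
Proof. unfold ext_elt, ext_mul; simpl. now rewrite Z.mul_0_r, add0. Qed.
Lemma ext_int_add x y : ext_int (x + y) = ext_add (ext_int x) (ext_int y).
Proof. unfold ext_int, ext_add; simpl. now rewrite add0. Qed.
Lemma ext_int_mul x y : ext_int (x * y) = ext_mul (ext_int x) (ext_int y).
Proof. unfold ext_int, ext_mul; simpl. now rewrite !zmul_zero, add0. Qed.
Lemma ext_int_opp x : ext_int (- x) = ext_opp (ext_int x).
Proof. unfold ext_int, ext_opp; simpl. now rewrite opp0. Qed.

Ltac zmod_ring :=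
  apply ext_elt_inj;
  rewrite <- ?Z.add_opp_r;
  repeat first
    [ rewrite ext_elt_add | rewrite ext_elt_opp | rewrite ext_elt_zmul
    | rewrite ext_elt_zero | rewrite ext_int_add | rewrite ext_int_mul
    | rewrite ext_int_opp ];
  ring.

(** * The lattice order and its translation invariance *)

Lemma le_refl a : a [<=] a.
Proof. unfold leA. now rewrite <- (joinK a a) at 2; rewrite meetK. Qed.

Lemma le_trans b a c : a [<=] b -> b [<=] c -> a [<=] c.
Proof. unfold leA. intros H1 H2. now rewrite <- H1, <- meetA, H2. Qed.

Lemma le_antisym a b : a [<=] b -> b [<=] a -> a = b.
Proof. unfold leA. intros H1 H2. now rewrite <- H1, meetC. Qed.

Lemma meet_lel a b : a [/\] b [<=] a.
Proof. unfold leA. rewrite (meetC a b), <- meetA. now rewrite (le_refl a). Qed.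

Lemma meet_ler a b : a [/\] b [<=] b.
Proof. rewrite meetC. apply meet_lel. Qed.

Lemma meet_glb a b c : c [<=] a -> c [<=] b -> c [<=] a [/\] b.
Proof. unfold leA. intros H1 H2. now rewrite meetA, H1, H2. Qed.

Lemma le_join a b : a [<=] b -> a [\/] b = b.
Proof. unfold leA. intros H. rewrite <- H, joinC, meetC. apply joinK. Qed.

Lemma join_le a b : a [\/] b = b -> a [<=] b.
Proof. unfold leA. intros <-. apply meetK. Qed.

Lemma join_ubl a b : a [<=] a [\/] b.
Proof. apply meetK. Qed.

Lemma join_ubr a b : b [<=] a [\/] b.
Proof. rewrite joinC. apply join_ubl. Qed.

Lemma join_lub a b c : a [<=] c -> b [<=] c -> a [\/] b [<=] c.
Proof.
intros H1 H2. apply join_le. now rewrite <- joinA, (le_join _ _ H2), le_join.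
Qed.

Lemma le_addl a b c : a [<=] b -> c [+] a [<=] c [+] b.
Proof. intros H. apply join_le. now rewrite <- add_joinr, (le_join _ _ H). Qed.

(** Translation invariance in the form used throughout: a linear inequality follows from another as
    soon as [zmod_ring] shows that both have the same difference of sides. *)
Lemma le_lin a b c d : a [<=] b -> d [-] c = b [-] a -> c [<=] d.
Proof.
intros H E. replace c with ((c [-] a) [+] a) by zmod_ring.
replace d with ((c [-] a) [+] b); [now apply le_addl|].
apply (add_cancel ([-] c)). rewrite (addC _ d), E. zmod_ring.
Qed.

Lemma le_add a b c d : a [<=] b -> c [<=] d -> a [+] c [<=] b [+] d.
Proof.
intros H1 H2. apply (le_trans (a [+] d)); [now apply le_addl|].
apply (le_lin a b); [easy|zmod_ring].
Qed.

(** * Positive parts and disjointness *)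

Definition pos a : G := a [\/] zero.

Lemma le_pos a : a [<=] pos a.
Proof. apply join_ubl. Qed.

Lemma pos_ge0 a : zero [<=] pos a.
Proof. apply join_ubr. Qed.

Lemma pos_lub a c : a [<=] c -> zero [<=] c -> pos a [<=] c.
Proof. apply join_lub. Qed.

Lemma pos_decomp a : pos a = a [+] pos ([-] a).
Proof. unfold pos. rewrite add_joinr, addN, add0. apply joinC. Qed.

(** Let [n] be the negative part of [a], so that the positive part is [a + n]. Then [n - w] is above
    both [-a] and [0], hence above [n]. *)
Lemma pos_disjoint a w : w [<=] pos a -> w [<=] pos ([-] a) -> w [<=] zero.
Proof.
intros H1 H2. rewrite pos_decomp in H1.
set (n := pos ([-] a)) in *.
assert (H : n [<=] n [-] w).
{ apply pos_lub.
  - apply (le_lin w (a [+] n)); [easy|zmod_ring].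
  - apply (le_lin w n); [easy|zmod_ring]. }
apply (le_lin n (n [-] w)); [easy|zmod_ring].
Qed.

Lemma le_opp_le0 a w : w [<=] a -> w [<=] [-] a -> w [<=] zero.
Proof.
intros H1 H2. apply (pos_disjoint a).
- now apply (le_trans a); [|apply le_pos].
- now apply (le_trans ([-] a)); [|apply le_pos].
Qed.

(** * Forcing by positive elements *)

(* In a representation of G by real-valued functions, [forces p h] says that
   [h >= 0] on the support of [p >= 0]. *)
Definition forces p h : Prop := p [/\] [-] h [<=] zero.

Definition condition p : Prop := zero [<=] p /\ ~ p [<=] zero.

Lemma forces_anti p q h : q [<=] p -> forces p h -> forces q h.
Proof.
intros H1. apply le_trans. apply meet_glb; [|apply meet_ler].
now apply (le_trans q); [apply meet_lel|].
Qed.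

Lemma forces_ge0 p h : zero [<=] h -> forces p h.
Proof.
intros H. apply (le_trans ([-] h)); [apply meet_ler|].
apply (le_lin zero h); [easy|zmod_ring].
Qed.

(** Strengthens the meet with [-h], which may change sign, to disjointness from the negative part of
    [h]. The meet [z] of [p] with that part satisfies [z - pos h <= p] and [z - pos h <= -h], so [z]
    is below both parts of [h]. *)
Lemma forces_neg p h : zero [<=] p -> forces p h -> forces p ([-] pos ([-] h)).
Proof.
unfold forces. rewrite oppK. intros Hp H. set (z := _ [/\] pos _).
assert (H1 : z [<=] p) by apply meet_lel.
assert (H2 : z [<=] pos ([-] h)) by apply meet_ler.
apply (pos_disjoint h); [|easy]. pose proof H2 as H3.
rewrite pos_decomp, oppK in H3.
assert (H4 : z [-] pos h [<=] zero).
{ apply (le_trans (p [/\] [-] h)); [|easy]. apply meet_glb.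
  - apply (le_trans z); [|easy].
    apply (le_lin zero (pos h)); [apply pos_ge0|zmod_ring].
  - apply (le_lin _ _ _ _ H3). zmod_ring. }
apply (le_lin _ _ _ _ H4). zmod_ring.
Qed.

(** With negative parts [x] and [y], the meet [w] of [p] and [x + y] satisfies [w - x <= y] and
    [w - x <= p]. Disjointness from [y] gives [w <= x], and disjointness from [x] then gives
    [w <= 0]. *)
Lemma forces_add p a b :
  zero [<=] p -> forces p a -> forces p b -> forces p (a [+] b).
Proof.
intros Hp Ha Hb. pose proof (forces_neg p a Hp Ha) as Ha'.
pose proof (forces_neg p b Hp Hb) as Hb'. unfold forces in Ha', Hb'.
rewrite oppK in Ha', Hb'. unfold forces.
set (x := pos ([-] a)) in *. set (y := pos ([-] b)) in *.
apply (le_trans (p [/\] (x [+] y))).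
{ apply meet_glb; [apply meet_lel|].
  apply (le_trans ([-] (a [+] b))); [apply meet_ler|].
  rewrite oppD. apply le_add; apply le_pos. }
set (w := _ [/\] _).
assert (H1 : w [<=] p) by apply meet_lel.
assert (H2 : w [<=] x [+] y) by apply meet_ler.
apply (le_trans (p [/\] x)); [|easy]. apply meet_glb; [easy|].
assert (H3 : w [-] x [<=] zero).
{ apply (le_trans (p [/\] y)); [|easy]. apply meet_glb.
  - apply (le_trans w); [|easy].
    apply (le_lin zero x); [apply pos_ge0|zmod_ring].
  - apply (le_lin _ _ _ _ H2). zmod_ring. }
apply (le_lin _ _ _ _ H3). zmod_ring.
Qed.

Lemma forces_natmul p n a : zero [<=] p -> forces p a -> forces p (natmul n a).
Proof.
intros Hp Ha. induction n as [|n IH]; simpl.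
- apply forces_ge0, le_refl.
- now apply forces_add.
Qed.

Lemma condition_extend p h : zero [<=] p -> ~ p [/\] h [<=] zero ->
  exists q, condition q /\ q [<=] p /\ forces q h.
Proof.
intros Hp H. exists (p [/\] pos h). split; [split|split].
- apply meet_glb; [easy|apply pos_ge0].
- intros H'. apply H. eapply le_trans; [|exact H'].
  apply meet_glb; [apply meet_lel|].
  eapply le_trans; [apply meet_ler|apply le_pos].
- apply meet_lel.
- unfold forces. apply (pos_disjoint h).
  + eapply le_trans; [apply meet_lel|apply meet_ler].
  + eapply le_trans; [apply meet_ler|apply le_pos].
Qed.

Lemma condition_decide p h : condition p ->
  exists q, condition q /\ q [<=] p /\ (forces q h \/ forces q ([-] h)).
Proof.
intros [Hp Hp']. destruct (classic (p [/\] h [<=] zero)) as [H|H].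
- exists p. split; [easy|]. split; [apply le_refl|right].
  unfold forces. now rewrite oppK.
- destruct (condition_extend p h Hp H) as (q & ? & ? & ?). exists q; tauto.
Qed.

(** If [w] is below [2 y_i] and [2 y_j], then [w - (y_i + y_j)] is below both [y_i - y_j] and its
    opposite, hence below 0. The resulting bound [y_i + y_j] has independent indices, which the
    hypothesis on [y] removes one after the other. *)
Lemma inf_double (I : Type) (y : I -> G) :
  (forall w, (forall i, w [<=] y i) -> w [<=] zero) ->
  forall w, (forall i, w [<=] y i [+] y i) -> w [<=] zero.
Proof.
intros Hy w Hw.
assert (H : forall i j, w [<=] y i [+] y j).
{ intros i j. apply (le_lin (w [-] (y i [+] y j)) zero); [|zmod_ring].
  apply (le_opp_le0 (y i [-] y j)).
  - apply (le_lin _ _ _ _ (Hw i)). zmod_ring.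
  - apply (le_lin _ _ _ _ (Hw j)). zmod_ring. }
apply Hy. intros i. apply (le_lin (w [-] y i) zero); [|zmod_ring].
apply Hy. intros j. apply (le_lin _ _ _ _ (H i j)). zmod_ring.
Qed.

Fixpoint double (k : nat) (a : G) : G :=
  match k with O => a | S k => double k a [+] double k a end.

Lemma inf_iter_double (I : Type) (y : I -> G) k :
  (forall w, (forall i, w [<=] y i) -> w [<=] zero) ->
  forall w, (forall i, w [<=] double k (y i)) -> w [<=] zero.
Proof.
intros Hy. induction k as [|k IH]; [easy|]. simpl. now apply inf_double.
Qed.

(** * Hoelder's construction for a total cone [P] with strong unit [u] *)

Section Cone.

Context (u : G) (H P : G -> Prop).
Context (Hu : H u) (Hsub : forall a b, H a -> H b -> H (a [-] b)).
Context (Padd : forall a b, P a -> P b -> P (a [+] b)).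
Context (Ptot : forall a, H a -> P a \/ P ([-] a)).
Context (Pneg : ~ P ([-] u)).
Context (Pbnd : forall a, H a -> exists n, P (natmul n u [-] a)).

Lemma subgroup_zero : H zero.
Proof. rewrite <- (addN u). now apply Hsub. Qed.

Lemma subgroup_opp a : H a -> H ([-] a).
Proof. intros. rewrite <- add0l. apply Hsub; [apply subgroup_zero|easy]. Qed.

Lemma subgroup_add a b : H a -> H b -> H (a [+] b).
Proof. intros. rewrite <- (oppK b). apply Hsub; [easy|now apply subgroup_opp]. Qed.

Lemma subgroup_zmul z a : H a -> H (z [*] a).
Proof.
intros Ha. assert (E : forall n, H (natmul n a)).
{ induction n; simpl; [apply subgroup_zero|now apply subgroup_add]. }
destruct z; simpl; [apply subgroup_zero|easy|now apply subgroup_opp].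
Qed.

Lemma cone_zero : P zero.
Proof. now destruct (Ptot zero subgroup_zero) as [|E]; [|rewrite opp0 in E]. Qed.

Lemma cone_zmul z a : (0 <= z)%Z -> P a -> P (z [*] a).
Proof.
intros Hz Ha. rewrite <- (Z2Nat.id z), zmul_natmul by easy.
induction (Z.to_nat z); simpl; [apply cone_zero|now apply Padd].
Qed.

Lemma cone_unit z : P (z [*] u) -> (0 <= z)%Z.
Proof.
intros Hz. destruct (Z_lt_le_dec z 0) as [L|]; [exfalso|easy].
apply Pneg. destruct (Ptot u Hu) as [Pu|]; [|easy].
(* For negative [z] the coefficient [- z - 1] is nonnegative, so [-u] would be a sum of two elements
   of the cone. *)
replace ([-] u) with (z [*] u [+] (- z - 1) [*] u) by zmod_ring.
apply Padd; [easy|]. apply cone_zmul; [lia|easy].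
Qed.

(** The lower cut of the ratio of [a] to [u]: [m / n] belongs to it when [m u <= n a] in the
    preorder given by [P]. *)
Definition cut a (r : R) : Prop :=
  exists n m, (0 < n)%Z /\ r = IZR m / IZR n /\ P (n [*] a [-] m [*] u).

Lemma cut_intro a n m : (0 < n)%Z -> P (n [*] a [-] m [*] u) ->
  cut a (IZR m / IZR n).
Proof. intros. now exists n, m. Qed.

Lemma cut_lub a : H a -> exists r, is_lub (cut a) r.
Proof.
intros Ha. destruct (completeness (cut a)) as [r Hr]; [| |now exists r].
- destruct (Pbnd a Ha) as [N HN]. exists (INR N).
  intros _ (n & m & Hn & -> & HP).
  assert (Hm : (0 <= n * Z.of_nat N - m)%Z).
  { apply cone_unit.
    replace ((n * Z.of_nat N - m) [*] u)
      with (n [*] (natmul N u [-] a) [+] (n [*] a [-] m [*] u)).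
    - apply Padd; [|easy]. apply cone_zmul; [lia|easy].
    - rewrite <- zmul_natmul. zmod_ring. }
  apply IZR_le in Hm. rewrite minus_IZR, mult_IZR, <- INR_IZR_INZ in Hm.
  apply IZR_lt in Hn. apply (Rmult_le_reg_r (IZR n)); [easy|].
  unfold Rdiv. rewrite Rmult_assoc, Rinv_l by lra. lra.
- destruct (Pbnd ([-] a) (subgroup_opp a Ha)) as [N HN].
  exists (IZR (- Z.of_nat N) / IZR 1). apply cut_intro; [lia|].
  replace (1 [*] a [-] (- Z.of_nat N) [*] u) with (natmul N u [-] [-] a); [easy|].
  rewrite <- zmul_natmul. zmod_ring.
Qed.

(** Choice makes this total on [G]; where the cut has no supremum the value is arbitrary. *)
Definition cut_sup a : R := epsilon (inhabits 0) (is_lub (cut a)).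

Lemma cut_sup_lub a : H a -> is_lub (cut a) (cut_sup a).
Proof. intros Ha. unfold cut_sup. apply epsilon_spec. now apply cut_lub. Qed.

(** Cuts add up after passing to a common denominator. The reverse inequality comes later, from the
    behaviour under [opp]. *)
Lemma cut_sup_superadd a b : H a -> H b ->
  cut_sup a + cut_sup b <= cut_sup (a [+] b).
Proof.
intros Ha Hb.
destruct (cut_sup_lub _ Ha) as [_ La]. destruct (cut_sup_lub _ Hb) as [_ Lb].
destruct (cut_sup_lub _ (subgroup_add _ _ Ha Hb)) as [U _].
assert (K : cut_sup a <= cut_sup (a [+] b) - cut_sup b).
{ apply La. intros r Hr.
  assert (cut_sup b <= cut_sup (a [+] b) - r); [|lra].
  apply Lb. intros r' Hr'.
  assert (r + r' <= cut_sup (a [+] b)); [|lra]. apply U.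
  destruct Hr as (n & m & Hn & -> & HP).
  destruct Hr' as (n' & m' & Hn' & -> & HP').
  replace (IZR m / IZR n + IZR m' / IZR n')
    with (IZR (n' * m + n * m') / IZR (n * n')).
  - apply cut_intro; [lia|].
    replace ((n * n') [*] (a [+] b) [-] (n' * m + n * m') [*] u)
      with (n' [*] (n [*] a [-] m [*] u) [+] n [*] (n' [*] b [-] m' [*] u))
      by zmod_ring.
    apply Padd; apply cone_zmul; trivial; lia.
  - apply IZR_lt in Hn, Hn'. rewrite plus_IZR, !mult_IZR. field. lra. }
lra.
Qed.

Lemma cut_sup_ge0 a : H a -> P a -> 0 <= cut_sup a.
Proof.
intros Ha HP. destruct (cut_sup_lub _ Ha) as [U _]. apply U.
replace 0 with (IZR 0 / IZR 1) by field. apply cut_intro; [lia|].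
now replace (1 [*] a [-] 0 [*] u) with a by zmod_ring.
Qed.

Lemma cut_sup_unit : cut_sup u = 1.
Proof.
destruct (cut_sup_lub _ Hu) as [U L]. apply Rle_antisym.
- apply L. intros _ (n & m & Hn & -> & HP).
  assert (Hm : (0 <= n - m)%Z).
  { apply cone_unit. now replace ((n - m) [*] u)
      with (n [*] u [-] m [*] u) by zmod_ring. }
  apply IZR_le in Hm. rewrite minus_IZR in Hm. apply IZR_lt in Hn.
  apply (Rmult_le_reg_r (IZR n)); [easy|].
  unfold Rdiv. rewrite Rmult_assoc, Rinv_l by lra. lra.
- apply U. replace 1 with (IZR 1 / IZR 1) at 1 by field. apply cut_intro; [lia|].
  replace (1 [*] u [-] 1 [*] u) with (@zero G) by zmod_ring. apply cone_zero.
Qed.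

Lemma cut_sup_zero : cut_sup zero = 0.
Proof.
pose proof subgroup_zero as H0. pose proof (cut_sup_superadd _ _ H0 H0) as E.
rewrite add0 in E. pose proof (cut_sup_ge0 _ H0 cone_zero). lra.
Qed.

Lemma cut_sup_opp a : H a -> cut_sup ([-] a) = - cut_sup a.
Proof.
intros Ha. pose proof (subgroup_opp _ Ha) as Hna.
pose proof (cut_sup_superadd _ _ Ha Hna) as E. rewrite addN, cut_sup_zero in E.
destruct (Rle_lt_dec (- cut_sup a) (cut_sup ([-] a))) as [|L]; [lra|exfalso].
(* A rational [m / n] in the gap: by totality either [m / n] lies in the cut of [a] or [- m / n]
   lies in that of [-a], and each exceeds the supremum. *)
destruct (lt_rational (cut_sup a) (- cut_sup ([-] a))) as (n & m & Hn & Hr1 & Hr2);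
  [lra|].
destruct (cut_sup_lub _ Ha) as [U _]. destruct (cut_sup_lub _ Hna) as [U' _].
destruct (Ptot (n [*] a [-] m [*] u)) as [HP|HP].
- apply Hsub; now apply subgroup_zmul.
- apply (cut_intro _ _ _ Hn) in HP. apply U in HP. lra.
- assert (cut ([-] a) (IZR (- m) / IZR n)) as K.
  { apply cut_intro; [easy|].
    now replace (n [*] ([-] a) [-] (- m) [*] u)
      with ([-] (n [*] a [-] m [*] u)) by zmod_ring. }
  apply U' in K. rewrite opp_IZR in K. unfold Rdiv in *. lra.
Qed.

Lemma cut_sup_add a b : H a -> H b -> cut_sup (a [+] b) = cut_sup a + cut_sup b.
Proof.
intros Ha Hb. apply Rle_antisym; [|now apply cut_sup_superadd].
pose proof (cut_sup_superadd ([-] a) ([-] b)) as K.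
rewrite <- oppD, !cut_sup_opp in K by auto using subgroup_add.
specialize (K (subgroup_opp _ Ha) (subgroup_opp _ Hb)). lra.
Qed.

End Cone.

(** With [join_pos], this reduces both lattice operations to subtraction and [pos], the only ones
    under which countable subsets are closed later. *)
Lemma meet_pos a b : a [/\] b = a [-] pos (a [-] b).
Proof.
apply le_antisym.
- assert (K : pos (a [-] b) [<=] a [-] (a [/\] b)).
  { apply pos_lub.
    - apply (le_lin _ _ _ _ (meet_ler a b)). zmod_ring.
    - apply (le_lin _ _ _ _ (meet_lel a b)). zmod_ring. }
  apply (le_lin _ _ _ _ K). zmod_ring.
- apply meet_glb.
  + apply (le_lin _ _ _ _ (pos_ge0 (a [-] b))). zmod_ring.
  + apply (le_lin _ _ _ _ (le_pos (a [-] b))). zmod_ring.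
Qed.

Lemma join_pos a b : a [\/] b = b [+] pos (a [-] b).
Proof. unfold pos. rewrite add_joinr, add0. f_equal. zmod_ring. Qed.

(** * Countable joins and the weak unit *)

Section Variety.

Context (HV : in_variety G).
Implicit Types (f : nat -> G) (g : G).

Lemma bigv_ub f g n : f n [/\] g [<=] bigv g f.
Proof.
destruct HV as (_ & _ & A2 & _). revert f.
induction n as [|n IH]; intros f; rewrite A2; [apply join_ubl|].
eapply le_trans; [|apply join_ubr]. apply (IH (fun n => f (S n))).
Qed.

(** Meeting the truncated terms with [h] does not change them, so (A3) applies after (A1). With
    [bigv_ub], [bigv g f] is the least upper bound of the [f n] truncated at [g]. *)
Lemma bigv_lub f g h : (forall n, f n [/\] g [<=] h) -> bigv g f [<=] h.
Proof.
destruct HV as (_ & A1 & _ & A3 & _). intros Hf. rewrite A1.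
replace (fun n => f n [/\] g) with (fun n => f n [/\] g [/\] h); [apply A3|].
apply functional_extensionality. intros n. apply Hf.
Qed.

Lemma absA_ge0 a : zero [<=] a -> absA a = a.
Proof.
intros Ha. unfold absA. rewrite joinC. apply le_join.
apply (le_trans zero); [|easy]. apply (le_lin _ _ _ _ Ha). zmod_ring.
Qed.

Lemma truncation_lub a h : zero [<=] a ->
  (forall n, a [/\] natmul (S n) one [<=] h) -> a [<=] h.
Proof.
destruct HV as (_ & _ & _ & _ & A4). intros Ha Hh.
rewrite <- (absA_ge0 a Ha), <- A4. apply bigv_lub. intros n.
rewrite absA_ge0 by easy. eapply le_trans; [apply meet_lel|apply Hh].
Qed.

Lemma weak_unit p : zero [<=] p -> forces p ([-] one) -> p [<=] zero.
Proof.
intros Hp H1. apply truncation_lub; [easy|]. intros n.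
assert (E : forall n, natmul n ([-] one) = [-] natmul n one :> G).
{ induction n0 as [|m IH]; simpl; [now rewrite opp0|now rewrite IH, oppD]. }
pose proof (forces_natmul p (S n) _ Hp H1) as K. unfold forces in K.
now rewrite E, oppK in K.
Qed.

(** The negative part of [one] is disjoint from [one], so it vanishes by [weak_unit]. *)
Lemma one_ge0 : (zero : G) [<=] one.
Proof.
assert (K : pos ([-] one) [<=] (zero : G)).
{ apply weak_unit; [apply pos_ge0|]. unfold forces. rewrite oppK.
  apply (pos_disjoint one).
  - eapply le_trans; [apply meet_ler|apply le_pos].
  - apply meet_lel. }
apply (le_trans _ _ _ (le_pos _)) in K. apply (le_lin _ _ _ _ K). zmod_ring.
Qed.

(** * Density of the required sets of conditions *)

Lemma condition_some (I : Type) (h : I -> G) p : condition p ->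
  ~ (forall i, p [/\] h i [<=] zero) ->
  exists q, condition q /\ q [<=] p /\ exists i, forces q (h i).
Proof.
intros [Hp _] H. apply not_all_ex_not in H. destruct H as [i Hi].
destruct (condition_extend p (h i) Hp Hi) as (q & H1 & H2 & H3).
exists q. split; [easy|]. split; [easy|now exists i].
Qed.

(** If no multiple of [one] could be forced above [h], every truncation of [pos h + p] at a multiple
    of [one] would lie below [pos h], whence [p <= 0]. *)
Lemma condition_bounded p h : condition p ->
  exists q, condition q /\ q [<=] p /\ exists n, forces q (natmul n one [-] h).
Proof.
intros Hp. apply condition_some; [easy|]. intros K. destruct Hp as [Hp Hp'].
apply Hp'. set (a := pos h).
assert (L : a [+] p [<=] a).
{ apply truncation_lub.
  - rewrite <- (add0 zero). apply le_add; [apply pos_ge0|easy].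
  - intros n. set (w := _ [/\] _).
    assert (M : w [-] a [<=] zero).
    { apply (le_trans (p [/\] (natmul (S n) one [-] h))); [|apply K].
      apply meet_glb.
      - apply (le_lin w (a [+] p)); [apply meet_lel|zmod_ring].
      - apply (le_trans (natmul (S n) one [-] a)).
        + apply (le_lin w (natmul (S n) one)); [apply meet_ler|zmod_ring].
        + apply (le_lin h a); [apply le_pos|zmod_ring]. }
    apply (le_lin _ _ _ _ M). zmod_ring. }
apply (le_lin _ _ _ _ L). zmod_ring.
Qed.

Lemma archimedean c : zero [<=] c -> (forall n, natmul n c [<=] one) -> c [<=] zero.
Proof.
intros Hc K. set (s := bigv one (fun n => natmul n c)).
assert (L : s [<=] s [-] c).
{ apply bigv_lub. intros n. apply (le_trans _ _ _ (meet_lel _ _)).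
  assert (M : natmul (S n) c [<=] s).
  { eapply le_trans; [|apply (bigv_ub _ _ (S n))].
    apply meet_glb; [apply le_refl|apply K]. }
  simpl in M. apply (le_lin _ _ _ _ M). zmod_ring. }
apply (le_lin _ _ _ _ L). zmod_ring.
Qed.

(** Otherwise [n c <= 1] for all [n] by induction: then [(n + 1) c - 1] is below [c], and its meet
    with [c] is at most 0. *)
Lemma condition_archimedean c : condition c ->
  exists q, condition q /\ q [<=] c /\ exists n, forces q (natmul n c [-] one).
Proof.
intros Hc. apply condition_some; [easy|]. intros K. destruct Hc as [Hc Hc'].
apply Hc'. apply archimedean; [easy|]. intros n. induction n as [|n IH].
- apply one_ge0.
- assert (L : natmul (S n) c [-] one [<=] zero).
  { eapply le_trans; [|apply (K (S n))]. apply meet_glb; [|apply le_refl].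
    simpl. apply (le_lin _ _ _ _ IH). zmod_ring. }
  apply (le_lin _ _ _ _ L). zmod_ring.
Qed.

Lemma double_ge0 k a : zero [<=] a -> zero [<=] double k a.
Proof.
intros Ha. induction k as [|k IH]; simpl; [easy|].
rewrite <- (add0 zero). now apply le_add.
Qed.

(** Makes some [y i] at most [1 / 2^k]. If this were impossible, the meet of [p] and [one] would be
    below every [2^k y_i], hence below 0, contradicting [weak_unit]. *)
Lemma condition_inf (I : Type) (y : I -> G) k p : condition p ->
  (forall i, zero [<=] y i) ->
  (forall w, (forall i, w [<=] y i) -> w [<=] zero) ->
  exists q, condition q /\ q [<=] p /\ exists i, forces q (one [-] double k (y i)).
Proof.
intros Hp Hy0 Hy. apply condition_some; [easy|]. intros K. destruct Hp as [Hp Hp'].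
apply Hp'. apply weak_unit; [easy|]. unfold forces. rewrite oppK.
apply (inf_iter_double I y k Hy). intros i. set (w := p [/\] one).
assert (L : w [-] double k (y i) [<=] zero).
{ eapply le_trans; [|apply (K i)]. apply meet_glb.
  - apply (le_trans w); [|apply meet_lel].
    apply (le_lin _ _ _ _ (double_ge0 k _ (Hy0 i))). zmod_ring.
  - apply (le_lin w one); [apply meet_ler|zmod_ring]. }
apply (le_lin _ _ _ _ L). zmod_ring.
Qed.

(** * Generic sequences and the homomorphism they define *)

(* The Rasiowa-Sikorski lemma for the order of conditions. *)
Lemma generic_sequence (D : nat -> G -> Prop) (c : G) : condition c ->
  (forall n p, condition p -> exists q, condition q /\ q [<=] p /\ D n q) ->
  exists s : nat -> G, (forall n, condition (s n)) /\ (forall n, s n [<=] c) /\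
    (forall m n, (m <= n)%nat -> s n [<=] s m) /\ (forall n, exists k, D n (s k)).
Proof.
intros Hc HD.
assert (N : exists next : nat -> G -> G, forall n p, condition p ->
  condition (next n p) /\ next n p [<=] p /\ D n (next n p)).
{ exists (fun n p => epsilon (inhabits p)
    (fun q => condition q /\ q [<=] p /\ D n q)).
  intros n p Hp. apply (epsilon_spec (inhabits p)
    (fun q => condition q /\ q [<=] p /\ D n q)). now apply HD. }
destruct N as [next N].
set (s := fix s n := match n with O => c | S n => next n (s n) end).
assert (Hs : forall n, condition (s n)).
{ induction n as [|n IH]; simpl; [easy|now apply N]. }
assert (A : forall m n, (m <= n)%nat -> s n [<=] s m).
{ intros m n L. induction L as [|n L IH]; [apply le_refl|].
  apply (le_trans (s n)); [|easy]. simpl. now apply N. }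
exists s. split; [easy|]. split; [|split; [easy|]].
- intros n. apply (A O). lia.
- intros n. exists (S n). simpl. now apply N.
Qed.

(** The clause with [2 ^ k] says that [x] keeps the infimum of each family [y n] equal to 0, which
    is how countable suprema are preserved. *)
Lemma generic_hom (e : nat -> G) (y : nat -> nat -> G) (c : G) :
  let H a := exists n, a = e n in
  H one -> (forall a b, H a -> H b -> H (a [-] b)) ->
  (forall a, H a -> H (pos a)) ->
  (forall n i, H (y n i) /\ zero [<=] y n i) ->
  (forall n w, (forall i, w [<=] y n i) -> w [<=] zero) ->
  H c -> condition c ->
  exists x : G -> R, x one = 1 /\
    (forall a b, H a -> H b -> x (a [+] b) = x a + x b) /\
    (forall a, H a -> x (pos a) = Rmax (x a) 0) /\
    (forall n k, exists i, 2 ^ k * x (y n i) <= 1) /\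
    0 < x c.
Proof.
intros H H1 Hsub Hpos Hy Hinf Hc Hcond.
(* Starting from a condition that forces [Nc] times [c] above [one] will make [x c] strictly
   positive. *)
destruct (condition_archimedean c Hcond) as (c' & Hc' & Lc & Nc & HNc).
(* The tag [t] selects the task: decide the sign of [e n], bound [e n], or make a member of [y n] at
   most [1 / 2^j]. *)
set (D k p := let (t, k1) := of_nat k in let (n, j) := of_nat k1 in
  match t with
  | O => forces p (e n) \/ forces p ([-] e n)
  | 1%nat => exists i, forces p (natmul i one [-] e n)
  | _ => exists i, forces p (one [-] double j (y n i))
  end).
assert (HD : forall t n j, D (to_nat (t, to_nat (n, j))) = fun p =>
  match t with
  | O => forces p (e n) \/ forces p ([-] e n)
  | 1%nat => exists i, forces p (natmul i one [-] e n)
  | _ => exists i, forces p (one [-] double j (y n i))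
  end).
{ intros. unfold D. now rewrite !cancel_of_to. }
destruct (generic_sequence D c' Hc') as (s & Hs & Hsc & Hsa & HsD).
{ intros k p Hp. unfold D. destruct (of_nat k) as [t k1].
  destruct (of_nat k1) as [n j]. destruct t as [|[|t]].
  - now apply condition_decide.
  - now apply condition_bounded.
  - apply (condition_inf nat (y n) j); [easy| |apply Hinf].
    intros i. apply Hy. }
set (P a := exists k, forces (s k) a).
assert (Padd : forall a b, P a -> P b -> P (a [+] b)).
{ intros a b [k Hk] [l Hl]. exists (k + l)%nat. apply forces_add; [apply Hs| |].
  - apply (forces_anti (s k)); [apply Hsa; lia|easy].
  - apply (forces_anti (s l)); [apply Hsa; lia|easy]. }
assert (Ptot : forall a, H a -> P a \/ P ([-] a)).
{ intros a [n ->]. destruct (HsD (to_nat (O, to_nat (n, O)))) as [k Hk].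
  rewrite HD in Hk. destruct Hk; [left|right]; now exists k. }
assert (Pneg : ~ P ([-] one)).
{ intros [k Hk]. apply (Hs k). apply weak_unit; [apply Hs|easy]. }
assert (Pbnd : forall a, H a -> exists n, P (natmul n one [-] a)).
{ intros a [n ->]. destruct (HsD (to_nat (1%nat, to_nat (n, O)))) as [k Hk].
  rewrite HD in Hk. destruct Hk as [i Hi]. exists i. now exists k. }
set (x := cut_sup one P).
assert (Xadd : forall a b, H a -> H b -> x (a [+] b) = x a + x b)
  by (intros; now apply (cut_sup_add one H)).
assert (Xge : forall a, H a -> P a -> 0 <= x a)
  by (intros; now apply (cut_sup_ge0 one H)).
assert (Xopp : forall a, H a -> x ([-] a) = - x a)
  by (intros; now apply (cut_sup_opp one H)).
assert (X1 : x one = 1) by now apply (cut_sup_unit one H).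
assert (Hopp : forall a, H a -> H ([-] a))
  by (intros; now apply (subgroup_opp one)).
assert (Hadd : forall a b, H a -> H b -> H (a [+] b))
  by (intros; now apply (subgroup_add one)).
exists x. split; [easy|]. split; [easy|]. split; [|split].
- intros a Ha. pose proof (Hpos _ Ha) as Hpa.
  pose proof (Hpos _ (Hopp _ Ha)) as Hpna.
  assert (K : 0 <= x (pos a)).
  { apply Xge; [easy|]. exists O. apply forces_ge0, pos_ge0. }
  assert (K' : 0 <= x (pos ([-] a))).
  { apply Xge; [easy|]. exists O. apply forces_ge0, pos_ge0. }
  assert (E : x (pos a) = x a + x (pos ([-] a))).
  { rewrite <- Xadd by auto. now rewrite <- pos_decomp. }
  (* Whichever sign of [a] is forced, the opposite part is forced to be at most 0, so [x] sends it
     to 0. *)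
  destruct (Ptot a Ha) as [[k Hk]|[k Hk]].
  + assert (L : 0 <= x ([-] pos ([-] a))).
    { apply Xge; [auto|]. exists k. apply forces_neg; [apply Hs|easy]. }
    rewrite Xopp in L by easy. rewrite Rmax_left; lra.
  + assert (L : 0 <= x ([-] pos a)).
    { apply Xge; [auto|]. exists k. rewrite <- (oppK a) at 1.
      apply forces_neg; [apply Hs|easy]. }
    rewrite Xopp in L by easy. rewrite Rmax_right; lra.
- intros n j. destruct (HsD (to_nat (2%nat, to_nat (n, j)))) as [k Hk].
  rewrite HD in Hk. destruct Hk as [i Hi]. exists i.
  assert (E : H (double j (y n i)) /\ x (double j (y n i)) = 2 ^ j * x (y n i)).
  { clear Hi. induction j as [|j [IH1 IH2]]; simpl.
    - split; [apply Hy|lra].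
    - split; [auto|]. rewrite Xadd, IH2 by easy. lra. }
  destruct E as [E1 E2].
  assert (L : 0 <= x (one [-] double j (y n i))).
  { apply Xge; [auto|now exists k]. }
  rewrite Xadd, Xopp, X1, E2 in L by auto. lra.
- assert (E : forall n, H (natmul n c) /\ x (natmul n c) = INR n * x c).
  { induction n as [|n [IH1 IH2]].
    - split; [exact (subgroup_zero one H H1 Hsub)|]. simpl. rewrite Rmult_0_l.
      now apply (cut_sup_zero one H).
    - split; [simpl; auto|]. rewrite S_INR. simpl. rewrite Xadd, IH2 by easy. lra. }
  destruct (E Nc) as [E1 E2].
  assert (L : 0 <= x (natmul Nc c [-] one)).
  { apply Xge; [auto|]. exists O. now apply (forces_anti c'). }
  rewrite Xadd, Xopp, X1, E2 in L by auto.
  apply Rnot_le_lt. intros M. pose proof (pos_INR Nc).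
  assert (INR Nc * x c <= 0); [|lra].
  rewrite <- (Rmult_0_r (INR Nc)). now apply Rmult_le_compat_l.
Qed.

(** * Countable subgroups and points respecting countably many sequences *)

Inductive span (e : nat -> G) : G -> Prop :=
| span_gen n : span e (e n)
| span_sub a b : span e a -> span e b -> span e (a [-] b)
| span_pos a : span e a -> span e (pos a).

(** [ev d k] evaluates the term of depth at most [d] coded by [k], the first component of the code
    being the outermost operation. *)
Lemma span_countable (e : nat -> G) :
  exists e' : nat -> G, forall a, span e a <-> exists n, a = e' n.
Proof.
set (ev := fix ev (d k : nat) : G := match d with
  | O => e k
  | S d => let (t, k1) := of_nat k in let (i, j) := of_nat k1 in
    match t with
    | O => e k1
    | 1%nat => ev d i [-] ev d j
    | _ => pos (ev d k1)
    end
  end).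
assert (Hev : forall (d : nat) k, span e (ev d k)).
{ induction d as [|d IH]; intros k; simpl; [constructor|].
  destruct (of_nat k) as [t k1]. destruct (of_nat k1) as [i j].
  destruct t as [|[|t]]; now constructor. }
(* Asking for a code at every large depth lets two subterms be evaluated at a common depth. *)
assert (Hspan : forall a, span e a ->
  exists d0 : nat, forall d : nat, (d0 <= d)%nat -> exists k, a = ev d k).
{ intros a Ha.
  induction Ha as [n|a b _ [da IHa] _ [db IHb]|a _ [da IHa]].
  - exists O. intros d _. destruct d as [|d]; [now exists n|].
    exists (to_nat (O, n)). cbn -[to_nat of_nat]. rewrite cancel_of_to. now destruct (of_nat n).
  - exists (S (da + db)). intros [|d] L; [lia|].
    destruct (IHa d) as [i ->]; [lia|]. destruct (IHb d) as [j ->]; [lia|].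
    exists (to_nat (1%nat, to_nat (i, j))). cbn -[to_nat of_nat]. now rewrite !cancel_of_to.
  - exists (S da). intros [|d] L; [lia|].
    destruct (IHa d) as [i ->]; [lia|].
    exists (to_nat (2%nat, i)). cbn -[to_nat of_nat]. rewrite cancel_of_to. now destruct (of_nat i). }
exists (fun n => let (d, k) := of_nat n in ev d k). intros a. split.
- intros Ha. destruct (Hspan a Ha) as [d Hd].
  destruct (Hd d (le_n d)) as [k ->]. exists (to_nat (d, k)).
  now rewrite cancel_of_to.
- intros [n ->]. destruct (of_nat n). apply Hev.
Qed.

(** One sequence supplies the operands of every operation: entries 0 and 1 for the finitary ones,
    entry 0 as the bound and the later entries as the terms of [bigv]. *)
Definition respects (x : G -> R) (c : nat -> G) : Prop :=
  x zero = 0 /\ x one = 1 /\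
  x (c 0%nat [+] c 1%nat) = x (c 0%nat) + x (c 1%nat) /\
  x ([-] c 0%nat) = - x (c 0%nat) /\
  x (c 0%nat [\/] c 1%nat) = Rmax (x (c 0%nat)) (x (c 1%nat)) /\
  x (c 0%nat [/\] c 1%nat) = Rmin (x (c 0%nat)) (x (c 1%nat)) /\
  x (bigv (c 0%nat) (fun n => c (S n))) =
    R_bigv (x (c 0%nat)) (fun n => x (c (S n))).

Lemma exists_respecting (c : nat -> nat -> G) (a b : G) : ~ a [<=] b ->
  exists x, (forall n, respects x (c n)) /\ x b < x a.
Proof.
intros Hab.
set (s n := bigv (c n O) (fun i => c n (S i))).
(* Row 0 lists [one], [a] and [b]; row [n + 1] lists the join [s n] followed by the sequence
   [c n]. *)
set (e k := let (n, i) := of_nat k in match n, i with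
  | O, O => one | O, 1%nat => a | O, _ => b
  | S n, O => s n | S n, S i => c n i end).
destruct (span_countable e) as [e' He'].
assert (H1 : span e one) by exact (span_gen e (to_nat (O, O))).
assert (Ha : span e a).
{ replace a with (e (to_nat (O, 1%nat))); [apply span_gen|].
  unfold e. now rewrite cancel_of_to. }
assert (Hb : span e b).
{ replace b with (e (to_nat (O, 2%nat))); [apply span_gen|].
  unfold e. now rewrite cancel_of_to. }
assert (Hs : forall n, span e (s n)).
{ intros n. replace (s n) with (e (to_nat (S n, O))); [apply span_gen|].
  unfold e. now rewrite cancel_of_to. }
assert (Hc : forall n i, span e (c n i)).
{ intros n i. replace (c n i) with (e (to_nat (S n, S i))); [apply span_gen|].
  unfold e. now rewrite cancel_of_to. }
assert (H0 : span e zero) by (rewrite <- (addN one); now constructor).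
assert (Hopp : forall p, span e p -> span e ([-] p))
  by (intros; rewrite <- add0l; now constructor).
assert (Hmeet : forall p q, span e p -> span e q -> span e (p [/\] q)).
{ intros. rewrite meet_pos. now repeat constructor. }
(* The differences between [s n] and its truncated terms have infimum 0 because [s n] is their least
   upper bound. *)
destruct (generic_hom e' (fun n i => s n [-] (c n (S i) [/\] c n O)) (pos (a [-] b)))
  as (x & X1 & Xadd & Xpos & Xinf & Xab).
- now apply He'.
- intros p q Hp Hq. apply He'. apply He' in Hp, Hq. now constructor.
- intros p Hp. apply He'. apply He' in Hp. now constructor.
- intros n i. split; [apply He'; constructor; auto|].
  pose proof (bigv_ub (fun i => c n (S i)) (c n O) i) as L.
  apply (le_lin _ _ _ _ L). unfold s. zmod_ring.
- intros n w Hw. assert (L : s n [<=] s n [-] w).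
  { apply bigv_lub. intros i. apply (le_lin _ _ _ _ (Hw i)). zmod_ring. }
  apply (le_lin _ _ _ _ L). zmod_ring.
- apply He'. now repeat constructor.
- split; [apply pos_ge0|]. intros L. apply Hab.
  apply (le_trans _ _ _ (le_pos _)) in L. apply (le_lin _ _ _ _ L). zmod_ring.
- assert (Xadd' : forall p q, span e p -> span e q -> x (p [+] q) = x p + x q)
    by (intros; apply Xadd; now apply He').
  assert (Xpos' : forall p, span e p -> x (pos p) = Rmax (x p) 0)
    by (intros; apply Xpos; now apply He').
  assert (X0 : x zero = 0).
  { pose proof (Xadd' _ _ H0 H0) as E. rewrite add0 in E. lra. }
  assert (Xopp : forall p, span e p -> x ([-] p) = - x p).
  { intros p Hp. pose proof (Xadd' _ _ Hp (Hopp _ Hp)) as E.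
    rewrite addN, X0 in E. lra. }
  assert (Xsub : forall p q, span e p -> span e q -> x (p [-] q) = x p - x q).
  { intros p q Hp Hq. rewrite Xadd', Xopp by auto. lra. }
  assert (Xmeet : forall p q, span e p -> span e q -> x (p [/\] q) = Rmin (x p) (x q)).
  { intros p q Hp Hq.
    rewrite meet_pos, Xsub, Xpos', Xsub by (repeat constructor; auto).
    unfold Rmax, Rmin. repeat destruct Rle_dec; lra. }
  exists x. split.
  + intros n. repeat split; auto.
    * rewrite join_pos, Xadd', Xpos', Xsub by (repeat constructor; auto).
      unfold Rmax. repeat destruct Rle_dec; lra.
    * symmetry. apply R_bigv_unique. fold (s n).
      assert (E : forall i, 0 <= x (s n) - Rmin (x (c n (S i))) (x (c n O))).
      { intros i. rewrite <- Xmeet, <- Xsub by auto.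
        set (w := s n [-] _). replace w with (pos w).
        - rewrite Xpos'; [apply Rmax_r|]. constructor; auto.
        - unfold pos. rewrite joinC. apply le_join.
          pose proof (bigv_ub (fun i => c n (S i)) (c n O) i) as L.
          apply (le_lin _ _ _ _ L). unfold w, s. zmod_ring. }
      split.
      -- intros _ [i ->]. specialize (E i). lra.
      -- intros M HM. apply Rnot_lt_le. intros L.
         (* For an upper bound [M < x (s n)], this [k] makes [2 ^ k * (x (s n) - M)] at least 2,
            while some term is within [1 / 2^k] of [x (s n)]. *)
         destruct (Pow_x_infinity 2) with (b := 2 * / (x (s n) - M)) as [k Hk].
         { rewrite Rabs_right; lra. }
         specialize (Hk k (le_n k)).
         destruct (Xinf n k) as [i Hi]. rewrite Xsub, Xmeet in Hi by auto.
         assert (HMi : Rmin (x (c n (S i))) (x (c n O)) <= M) by (apply HM; now exists i).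
         rewrite Rabs_right in Hk by (apply Rle_ge, pow_le; lra).
         assert (P : 0 < 2 ^ k) by (apply pow_lt; lra).
         assert (2 <= 2 ^ k * (x (s n) - M)).
         { replace 2 with (2 * / (x (s n) - M) * (x (s n) - M)) at 1 by (field; lra).
           apply Rmult_le_compat_r; lra. }
         assert (2 ^ k * (x (s n) - M) <=
           2 ^ k * (x (s n) - Rmin (x (c n (S i))) (x (c n O)))); [|lra].
         apply Rmult_le_compat_l; lra.
  + rewrite Xpos', Xsub in Xab by (repeat constructor; auto).
    unfold Rmax in Xab. destruct Rle_dec; lra.
Qed.

End Variety.

End LatticeGroup.

(** * The congruence on the power of [R] *)

(** Equality modulo the filter generated by the sets of points that respect countably many
    sequences. *)
Definition ae_eq {G : SigAlg} (y z : (G -> R) -> R) : Prop :=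
  exists c : nat -> nat -> G, forall x, (forall n, respects x (c n)) -> y x = z x.

Lemma ae_eq_pointwise {G : SigAlg} (y z : (G -> R) -> R) :
  (forall x, y x = z x) -> ae_eq y z.
Proof. intros H. exists (fun _ _ => zero). auto. Qed.

(** The filter is closed under countable intersections: witnesses are chosen for each [n] and merged
    into one by pairing. *)
Lemma ae_eq_countable {G : SigAlg} (f f' : nat -> (G -> R) -> R) (y z : (G -> R) -> R) :
  (forall n, ae_eq (f n) (f' n)) ->
  (forall x, (forall n, f n x = f' n x) -> y x = z x) -> ae_eq y z.
Proof.
intros Hf Hyz.
set (good n := fun c : nat -> nat -> G =>
  forall x, (forall m, respects x (c m)) -> f n x = f' n x).
set (c n := epsilon (inhabits (fun _ _ => zero)) (good n)).
assert (Hc : forall n, good n (c n)) by (intros n; apply epsilon_spec, Hf).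
exists (fun k => let (n, m) := of_nat k in c n m). intros x Hx.
apply Hyz. intros n. apply Hc. intros m.
specialize (Hx (to_nat (n, m))). now rewrite cancel_of_to in Hx.
Qed.

Lemma ae_eq_binary {G : SigAlg} (f g f' g' y z : (G -> R) -> R) :
  ae_eq f f' -> ae_eq g g' ->
  (forall x, f x = f' x -> g x = g' x -> y x = z x) -> ae_eq y z.
Proof.
intros Hf Hg Hyz.
apply (ae_eq_countable (fun n => match n with O => f | _ => g end)
                       (fun n => match n with O => f' | _ => g' end)).
- now intros [|n].
- intros x Hx. apply Hyz; [apply (Hx O)|apply (Hx 1%nat)].
Qed.

Lemma ae_eq_congruence (G : SigAlg) :
  congruence (A := power_alg (G -> R) R_alg) ae_eq.
Proof.
repeat split.
- intros y. now apply ae_eq_pointwise.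
- intros y z H. apply (ae_eq_binary _ _ _ _ _ _ H H). auto.
- intros y z t H H'. apply (ae_eq_binary _ _ _ _ _ _ H H').
  intros x. now intros -> ->.
- intros y y' z z' H H'. apply (ae_eq_binary _ _ _ _ _ _ H H').
  intros x E E'. simpl. now rewrite E, E'.
- intros y y' H. apply (ae_eq_binary _ _ _ _ _ _ H H).
  intros x E _. simpl. now rewrite E.
- intros y y' z z' H H'. apply (ae_eq_binary _ _ _ _ _ _ H H').
  intros x E E'. simpl. now rewrite E, E'.
- intros y y' z z' H H'. apply (ae_eq_binary _ _ _ _ _ _ H H').
  intros x E E'. simpl. now rewrite E, E'.
- intros g g' f f' Hg Hf.
  apply (ae_eq_countable (fun n => match n with O => g | S n => f n end)
                         (fun n => match n with O => g' | S n => f' n end)).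
  + intros [|n]; [easy|apply Hf].
  + intros x Hx. simpl. f_equal; [apply (Hx O)|].
    apply functional_extensionality. intros n. apply (Hx (S n)).
Qed.

Lemma ae_eq_respects {G : SigAlg} (c : nat -> G) (y z : (G -> R) -> R) :
  (forall x, respects x c -> y x = z x) -> ae_eq y z.
Proof. intros H. exists (fun _ => c). intros x Hx. apply H, (Hx O). Qed.

Theorem mainTheorem13 :
  forall G : SigAlg, in_variety G ->
  exists (I : Type) (th : power_alg I R_alg -> power_alg I R_alg -> Prop)
         (phi : G -> power_alg I R_alg),
    congruence th /\ quot_embedding th phi.
Proof.
intros G HV. pose proof (proj1 HV) as HG.
exists (G -> R), ae_eq, (fun a x => x a). split; [apply ae_eq_congruence|].
assert (Hpair : forall (a b : G) y z,
  (forall x, respects x (fun n => match n with O => a | _ => b end) -> y x = z x) ->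
  ae_eq y z) by (intros a b y z; apply ae_eq_respects).
repeat split.
- apply (Hpair zero zero). intros x Hx. apply Hx.
- intros a b. apply (Hpair a b). intros x Hx. apply Hx.
- intros a. apply (Hpair a a). intros x Hx. apply Hx.
- intros a b. apply (Hpair a b). intros x Hx. apply Hx.
- intros a b. apply (Hpair a b). intros x Hx. apply Hx.
- intros g f. apply (ae_eq_respects (fun n => match n with O => g | S n => f n end)).
  intros x Hx. apply Hx.
- apply (Hpair zero zero). intros x Hx. apply Hx.
(* If [a] and [b] differed, a point respecting the witness [c] of the congruence would separate
   them. *)
- intros a b [c Hc].
  apply (le_antisym HG); apply NNPP; intros L;
    destruct (exists_respecting HG HV c _ _ L) as (x & Hx & Hlt);
    specialize (Hc x Hx); simpl in Hc; lra.
Qed.
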